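(* Let $q=2^m$, let $t\ge 2$, and let $H\subset K=AG(2,q)$ be a star-set (with parameter $t$). Then $H$ is a KM-arc of type $t$ with $t$-nucleus at $0$ if and only if for each $v\in S$ and each integer $k$ with $1\le k\le q-2$, $$\sum_{y\in H}\langle v,y\rangle^k=0 .$$
   Context: Let $q=2^m$ ($m\ge1$), $F=\mathbb{F}_q$, $K=\mathbb{F}_{q^2}\supset F$. For $x\in K$ put $\bar x=x^q$. Let $S=\{u\in K\mid u\bar u=1\}$ and $\langle x,y\rangle=x\bar y+\bar x y\in F$ for $x,y\in K$. The projective plane $PG(2,q)$ is represented as follows: points are pairs $(x:z)$ with $x\in K$, $z\in F$, $(x,z)\neq(0,0)$, up to multiplication by $F^*$; lines are $[\alpha:\beta]=\{(x:z)\mid \langle\alpha,x\rangle+\beta z=0\}$ with $\alpha\in K$, $\beta\in F$, $(\alpha,\beta)\ne(0,0)$. The line at infinity is $[0:1]$. The affine plane $AG(2,q)=PG(2,q)\setminus[0:1]$ is identified with $K$ via $(x:1)\leftrightarrow x$; its lines are $\{x\in K\mid\langle u,x\rangle+\mu=0\}$ with $u\in S$, $\mu\in F$. A KM-arc of type $t$ in $PG(2,q)$ is a set of $q+t$ points meeting every line in $0$, $2$ or $t$ points. A $t$-secant is a line meeting it in exactly $t$ points. For $2<t<q$ it is known that all $t$-secants of a KM-arc of type $t$ pass through one common point, called its $t$-nucleus. For $t=2$ any point not on $H$ is regarded as a $2$-nucleus of $H$. Star-set: for $t\ge2$, a set $H$ of $q+t$ points of $K=AG(2,q)$ is a star-set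 if all points of $H$ belong to a union of $\frac{q}{t}+1$ lines concurrent at $0$ (in particular $t\mid q$), and each of these lines contains $t$ points of $H$. *)

(* Defs.v *)
From HB Require Import structures.
From mathcomp Require Import all_boot all_order all_algebra.

Set Implicit Arguments.
Unset Strict Implicit.
Unset Printing Implicit Defensive.

Import GRing.Theory.
Local Open Scope ring_scope.

(* The inclusion of F = GF(q) in K = GF(q^2) is a ring morphism
   iota : {rmorphism F -> K} (automatically injective), and q is #|F|. *)
Section Plane.
Variables (F K : finFieldType) (iota : {rmorphism F -> K}).

Definition bar (x : K) : K := x ^+ #|F|.

(* This takes its values in the image of iota when #|K| = #|F| ^ 2. *)
Definition pairing (x y : K) : K := x * bar y + bar x * y.

Definition unit_circle : {set K} := [set u | u * bar u == 1].

(* A projective point (x : z) is the set of all its homogeneous coordinates. *)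
Definition proj_class (p : K * F) : {set K * F} :=
  [set (iota c * p.1, c * p.2) | c : F & c != 0].

Definition is_point (P : {set K * F}) : bool :=
  [exists p : K * F, (p != (0, 0)) && (P == proj_class p)].

Definition PG : finType := {P : {set K * F} | is_point P}.

(* The condition does not depend on the choice of homogeneous coordinates. *)
Definition line (a : K) (b : F) : {set PG} :=
  [set P : PG |
    [forall p in val P, pairing a p.1 + iota (b * p.2) == 0]].

Definition lines : {set {set PG}} :=
  [set line ab.1 ab.2 | ab : K * F & ab != (0, 0)].

Lemma is_point_affine (x : K) : is_point (proj_class (x, 1)).
Proof.
by apply/existsP; exists (x, 1); rewrite eqxx andbT xpair_eqE oner_eq0 andbF.
Qed.

Definition affine (x : K) : PG :=
  exist is_point (proj_class (x, 1)) (is_point_affine x).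

Definition affine_line (u : K) (mu : F) : {set K} :=
  [set x | pairing u x + iota mu == 0].

Definition affine_lines : {set {set K}} :=
  [set affine_line u mu | u in unit_circle, mu in [set: F]].

Definition KM_arc (t : nat) (A : {set PG}) : Prop :=
  #|A| = (#|F| + t)%N /\
  (forall L, L \in lines -> #|A :&: L| \in [:: 0; 2; t]%N).

Definition t_secant (t : nat) (A L : {set PG}) : Prop :=
  L \in lines /\ #|A :&: L| = t.

(* Only meaningful for KM-arcs of type t with 2 <= t < q; t = 2 is a separate
   convention, since the 2-secants of a hyperoval are not concurrent. *)
Definition t_nucleus (t : nat) (A : {set PG}) (P : PG) : Prop :=
  if t == 2%N then is_true (P \notin A)
  else forall L, t_secant t A L -> P \in L.

Definition star_set (t : nat) (H : {set K}) : Prop :=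
  [/\ #|H| = (#|F| + t)%N, (t %| #|F|)%N &
      exists Ls : {set {set K}},
        [/\ Ls \subset affine_lines,
            forall L, L \in Ls -> 0 \in L,
            #|Ls| = (#|F| %/ t + 1)%N,
            H \subset cover Ls &
            forall L, L \in Ls -> #|H :&: L| = t]].

End Plane.

(* Main.v *)
Require Import Defs.
From HB Require Import structures.
From mathcomp Require Import all_boot all_order all_algebra.
From mathcomp Require Import finfield ring.

Set Implicit Arguments.
Unset Strict Implicit.
Unset Printing Implicit Defensive.

Import GRing.Theory.
Local Open Scope ring_scope.

(** Write N(a, c) for the number of y in H with <a, y> = c, so that N(a, c) is
    the number of points of H on an affine line with normal vector a.

    Both sides of the equivalence amount to: every N(a, c) with a <> 0 is even.

    The k-th power sum of <v, y> over H is the sum of N(v, c) c^k over c, and in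
    characteristic 2 only the parity of N(v, c) matters.  In a KM-arc of type t
    each line has 0, 2 or t points, all even since t divides q = 2^m; hence the
    power sums vanish [power_sum0_of_even_fibers].  Conversely, the numbers
    N(v, c) mod 2 are recovered by interpolation: for z in F, z^(q-1) is the
    indicator of z <> 0, so the sum over y of (<v, y> + c)^(q-1) is
    #|H| - N(v, c), and expanding the power expresses it through the power sums
    of exponents 0, ..., q-1.  The hypothesis handles 1, ..., q-2; the two
    extreme exponents count #|H| and #|H| - N(v, 0), which are even because
    N(v, 0), the number of points of H on a line through 0, is 0 or t in a
    star-set [even_fibers_of_power_sum0].  Rescaling passes from v in S to any
    nonzero normal vector [polar_decomposition].

    Parity then forces exact values.  Let y be in H.  Its line through 0 carries
    t points of H, so exactly q points of H lie off it.  Each of the q other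
    lines through y meets H evenly, hence in at least one of these q points, and
    therefore in exactly one [star_set_noncentral_secant].  Thus a line that
    misses 0 has 0 or 2 points of H, a line through 0 has 0 or t, and the line
    at infinity has none: H is a KM-arc, and for t <> 2 a t-secant must pass
    through 0; for t = 2 it remains that 0 is not in H [star_set_not0]. *)

(** * Parity of fibers and power sums in characteristic 2 *)

Definition fiber (T : finType) (R : eqType) (f : T -> R) (H : {set T}) (c : R)
  : {set T} := [set y in H | f y == c].

Section Char2PowerSums.
Variables (T : finType) (K : finFieldType) (f : T -> K) (H : {set T}).
Hypothesis char2 : 2 \in [pchar K].

Lemma natr_char2_eq0 n : (n%:R == 0 :> K) = ~~ odd n.
Proof. by rewrite -(dvdn_pcharf char2) dvdn2. Qed.

Lemma power_sum0_of_even_fibers k :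
  (forall c, ~~ odd #|fiber f H c|) -> \sum_(y in H) f y ^+ k = 0.
Proof.
move=> evH; rewrite (partition_big f xpredT) //= big1 // => c _.
transitivity (\sum_(y in fiber f H c) c ^+ k).
  by apply: eq_big => [y|y /andP[_ /eqP->] //]; rewrite inE.
rewrite sumr_const -mulr_natr.
by have /eqP-> : #|fiber f H c|%:R == 0 :> K; rewrite ?natr_char2_eq0 ?mulr0.
Qed.

(** Interpolation on the field with q elements: by Fermat, (f y + c)^(q-1)
    vanishes exactly when f y = c and is 1 otherwise, so its sum over H detects
    the parity of the fiber over c, while the binomial expansion expresses the
    same sum through the power sums of exponents 0, ..., q-1.  The parities of H
    and of the fiber over 0 account for the exponents 0 and q-1. *)
Lemma even_fibers_of_power_sum0 (q : nat) :
    (2 <= q)%N -> [pchar K].-nat q -> (forall y, y \in H -> f y ^+ q = f y) ->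
    (forall k, (1 <= k)%N -> (k <= q - 2)%N -> \sum_(y in H) f y ^+ k = 0) ->
    ~~ odd #|H| -> ~~ odd #|fiber f H 0| ->
  forall c, c ^+ q = c -> ~~ odd #|fiber f H c|.
Proof.
move=> q_ge2 qchar fq sums0 evH ev0 c cq.
have q_gt0 : (0 < q)%N by apply: leq_trans q_ge2.
have qE : q = q.-1.+1 by rewrite prednK.
have q1_gt0 : (0 < q.-1)%N by rewrite -ltnS -qE.
have pow1 (z : K) : z ^+ q = z -> z ^+ q.-1 = (z != 0)%:R.
  move=> zq; case: eqVneq => [->|z0]; first by rewrite expr0n eqn0Ngt q1_gt0.
  by apply: (mulfI z0); rewrite mulr1 -exprS -qE.
have sumE d : d ^+ q = d ->
    \sum_(y in H) (f y + d) ^+ q.-1 = #|H|%:R + #|fiber f H d|%:R.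
  move=> dq; transitivity (\sum_(y in H) (1 + (f y == d)%:R : K)).
    apply: eq_bigr => y Hy; rewrite pow1; last by rewrite exprDn_pchar // fq ?dq.
    rewrite addr_eq0 (oppr_pchar2 char2).
    by case: eqP; rewrite ?addr0 ?(addrr_pchar2 char2).
  rewrite big_split /= sumr_const; congr (_ + _).
  rewrite -sum1_card natr_sum big_mkcond [RHS]big_mkcond; apply: eq_bigr => y _.
  by rewrite inE; case: (y \in H); case: eqP.
have all_sums0 k : (k < q)%N -> \sum_(y in H) f y ^+ k = 0.
  rewrite {1}qE ltnS leq_eqVlt => /predU1P[->|k_lt].
    transitivity (\sum_(y in H) (f y + 0) ^+ q.-1).
      by apply: eq_bigr => y _; rewrite addr0.
    rewrite sumE ?expr0n ?eqn0Ngt ?q_gt0 //.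
    by apply/eqP; rewrite -natrD natr_char2_eq0 oddD (negbTE evH) (negbTE ev0).
  case: k k_lt => [_|k k_lt].
    by apply/eqP; rewrite sumr_const natr_char2_eq0.
  by apply: sums0; rewrite // subn2 -ltnS prednK.
have: \sum_(y in H) (f y + c) ^+ q.-1 == 0.
  under eq_bigr => y _ do rewrite addrC exprDn.
  rewrite exchange_big big1 //= => k _.
  transitivity (c ^+ (q.-1 - k) *+ 'C(q.-1, k) * \sum_(y in H) f y ^+ k).
    by rewrite mulr_sumr; apply: eq_bigr => y _; rewrite mulrnAl.
  by rewrite all_sums0 ?mulr0 // {2}qE.
by rewrite (sumE c cq) -natrD natr_char2_eq0 oddD (negbTE evH).
Qed.
End Char2PowerSums.

(** * The conjugation and the alternating form on K *)

Section HermitianPlane.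
Variables (m : nat) (F K : finFieldType) (iota : {rmorphism F -> K}).
Hypothesis hF : #|F| = (2 ^ m)%N.
Hypothesis hK : #|K| = (#|F| ^ 2)%N.

Local Notation bar := (bar F).
Local Notation pairing := (pairing F).

Lemma pcharK2 : (2%N \in [pchar K]).
Proof. by rewrite (fmorph_pchar iota) (card_finPcharP hF). Qed.

Let addxx (x : K) : x + x = 0 := addrr_pchar2 pcharK2 x.

Let addr_eq0_char2 (x y : K) : (x + y == 0) = (x == y).
Proof. by rewrite addr_eq0 (oppr_pchar2 pcharK2). Qed.

Lemma pchar_nat_card : [pchar K].-nat #|F|.
Proof. by rewrite hF pnatX pnatE // pcharK2. Qed.

Lemma barD (x y : K) : bar (x + y) = bar x + bar y.
Proof. exact: exprDn_pchar pchar_nat_card. Qed.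

Lemma barM (x y : K) : bar (x * y) = bar x * bar y.
Proof. exact: exprMn. Qed.

Lemma barK (x : K) : bar (bar x) = x.
Proof. by rewrite /Defs.bar -exprM -[RHS]expf_card hK. Qed.

Lemma bar_iota (c : F) : bar (iota c) = iota c.
Proof. by rewrite /Defs.bar -rmorphXn /= expf_card. Qed.

(** The polynomial X^q - X is the product of the X - c for c in F, so its roots
    in K are exactly the elements of F. *)
Lemma bar_fixed (x : K) : bar x = x -> exists c, x = iota c.
Proof.
move=> xq; have := congr1 (fun p => (map_poly iota p).[x]) (finField_genPoly F).
rewrite /= rmorphB /= map_polyXn map_polyX hornerD hornerN hornerXn hornerX.
rewrite [x ^+ _]xq subrr rmorph_prod horner_prod => /esym/eqP.
rewrite prodf_seq_eq0 => /hasP[c _ /=].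
by rewrite map_polyXsubC hornerXsubC subr_eq0 => /eqP; exists c.
Qed.

Lemma pairing_fixed (x y : K) : bar (pairing x y) = pairing x y.
Proof. by rewrite /Defs.pairing barD !barM !barK; ring. Qed.

Lemma pairingDr (a x y : K) : pairing a (x + y) = pairing a x + pairing a y.
Proof. by rewrite /Defs.pairing barD; ring. Qed.

Lemma pairingC (x y : K) : pairing x y = pairing y x.
Proof. by rewrite /Defs.pairing; ring. Qed.

Lemma pairingDl (a b x : K) : pairing (a + b) x = pairing a x + pairing b x.
Proof. by rewrite ![pairing _ x]pairingC pairingDr. Qed.

Lemma pairingZl l (a x : K) : bar l = l -> pairing (l * a) x = l * pairing a x.
Proof. by move=> lq; rewrite /Defs.pairing barM lq; ring. Qed.

Lemma pairingZr l (a x : K) : bar l = l -> pairing a (l * x) = l * pairing a x.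
Proof. by move=> lq; rewrite pairingC pairingZl // pairingC. Qed.

Lemma pairing_self (x : K) : pairing x x = 0.
Proof. by rewrite /Defs.pairing mulrC addxx. Qed.

Lemma pairing0l (x : K) : pairing 0 x = 0.
Proof. by rewrite -(addxx 0) pairingDl addxx. Qed.

Lemma pairing0r (x : K) : pairing x 0 = 0.
Proof. by rewrite pairingC pairing0l. Qed.

(** This is b <a, z> - a <b, z> = z <a, b>, valid modulo 2.  In terms of lines:
    two independent normal vectors define lines with a single common point. *)
Lemma pairing_nondegenerate (a b z : K) :
  pairing a b != 0 -> pairing a z = 0 -> pairing b z = 0 -> z = 0.
Proof.
move=> ab0 az bz; apply: contraNeq ab0 => z0; apply/eqP; apply: (mulfI z0).
rewrite mulr0; transitivity (b * pairing a z - a * pairing b z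
    + (z * a * bar b + z * a * bar b)); first by rewrite /Defs.pairing; ring.
by rewrite az bz addxx; ring.
Qed.

Lemma card_field_even : ~~ odd #|F|.
Proof. by have := finNzRing_gt1 F; rewrite hF oddX; case: (m). Qed.

(** The norm a a^q lies in F, where squaring is bijective, so it has a square
    root l in F, and a / l has norm 1. *)
Lemma polar_decomposition (a : K) : a != 0 ->
  exists l u, [/\ bar l = l, l != 0, u \in unit_circle F K & a = l * u].
Proof.
move=> a0.
set n := a * bar a.
have nq : bar n = n by rewrite barM barK mulrC.
have n0 : n != 0 by rewrite mulf_neq0 // expf_neq0.
(* As n ^+ q = n, the power n ^+ (q / 2) is a square root of n. *)
set l := n ^+ #|F|./2.
have lq : bar l = l by rewrite /Defs.bar -exprM mulnC exprM [n ^+ #|F|]nq.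
have l0 : l != 0 by rewrite expf_neq0.
have l2 : l * l = n by rewrite -exprD addnn even_halfK // card_field_even.
exists l, (l^-1 * a); split=> //; last by rewrite mulrA divff ?mul1r.
by rewrite inE barM [bar l^-1]exprVn [l ^+ #|F|]lq mulrACA -invfM l2 mulVf.
Qed.

(** On the unit circle the inverse of u is its conjugate, so <u, x> = 0 reads
    u^2 x^q = x; as squaring is injective in characteristic 2, x determines u.
    Hence a line through 0 has only one equation with a normal vector in S. *)
Lemma unit_circle_orthogonal_inj (u v x : K) :
    u \in unit_circle F K -> v \in unit_circle F K -> x != 0 ->
  pairing u x = 0 -> pairing v x = 0 -> u = v.
Proof.
have sqE w : w \in unit_circle F K -> pairing w x = 0 -> w * w * bar x = x.
  rewrite inE => /eqP w1 wx; apply/eqP; rewrite -addr_eq0_char2.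
  by rewrite -[X in _ + X]mul1r -w1 -!mulrA -mulrDr [_ + _]wx mulr0.
move=> uS vS x0 ux vx; apply/eqP; rewrite -addr_eq0_char2 -sqrf_eq0.
have xb0 : bar x != 0 by rewrite expf_neq0.
apply/eqP/(mulIf xb0); rewrite mul0r; transitivity
  (u * u * bar x + v * v * bar x + (u * v * bar x + u * v * bar x)); first ring.
by rewrite !sqE // !addxx ?addr0.
Qed.

(** * Secants of a star-set *)

Section StarSet.
Variables (t : nat) (H : {set K}).
Hypothesis t_gt1 : (2 <= t)%N.
Hypothesis H_star : star_set iota t H.

Lemma star_set_parameter_even : ~~ odd t.
Proof.
case: H_star => _ + _; rewrite hF => /(dvdn_pfactor _ _ (isT : prime 2))[k _ tE].
by move: t_gt1; rewrite tE oddX; case: k {tE}.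
Qed.

Lemma star_set_card_even : ~~ odd #|H|.
Proof.
case: H_star => -> _ _.
by rewrite oddD (negbTE card_field_even) (negbTE star_set_parameter_even).
Qed.

(** The q/t + 1 lines carry (q/t + 1) t = q + t = #|H| incidences with points of
    H.  As each point of H lies on one of them, none lies on two, whereas 0 lies
    on all of them and there are at least two. *)
Lemma star_set_not0 : 0 \notin H.
Proof.
case: H_star => cardH t_dvd [Ls [_ Ls0 cardLs HLs tLs]].
apply/negP => H0.
have t_gt0 : (0 < t)%N by apply: leq_trans t_gt1.
have cardLs_gt1 : (1 < #|Ls|)%N.
  rewrite cardLs addn1 ltnS divn_gt0 // dvdn_leq //.
  by apply/card_gt0P; exists (0 : F).
have incidences : (\sum_(x in H) \sum_(L in Ls) (x \in L))%N = #|H|.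
  rewrite exchange_big /=; transitivity (\sum_(L in Ls) t)%N.
    apply: eq_bigr => L /tLs <-; rewrite -sum1_card big_mkcond [RHS]big_mkcond.
    by apply: eq_bigr => x _; rewrite inE; case: (x \in H); case: (x \in L).
  by rewrite sum_nat_const cardLs cardH mulnDl divnK // mul1n.
have := leqnn #|H|; rewrite -{1}incidences (bigD1 0) //= leqNgt => /negP; apply.
rewrite (cardsD1 (0 : K) H) H0.
rewrite (eq_bigr (fun _ => 1%N)) => [|L /Ls0->] //; rewrite sum1_card.
have le1 : (#|H :\ (0%R : K)|
    <= \sum_(x in H | x != 0%R) \sum_(L in Ls) (x \in L))%N.
  rewrite -sum1_card big_mkcond [X in (_ <= X)%N]big_mkcond.
  apply: leq_sum => x _; rewrite !inE andbC; case: ifP => // /andP[Hx _].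
  have /bigcupP[L LsL Lx] := subsetP HLs x Hx.
  by rewrite (bigD1 L) //= Lx.
exact: (leq_add cardLs_gt1 le1).
Qed.

(** Two distinct lines through 0 meet only in 0, which is not in H; so a line
    through 0 outside the given pencil misses H. *)
Lemma star_set_central_line a : a != 0 ->
  #|fiber (pairing a) H 0| = 0%N \/ #|fiber (pairing a) H 0| = t.
Proof.
case/polar_decomposition=> l [u [lq l0 uS ->]].
case: H_star => _ _ [Ls [/subsetP Ls_affine Ls0 _ HLs tLs]].
have fiberE : fiber (pairing (l * u)) H 0 = H :&: affine_line iota u 0.
  apply/setP => x; rewrite !inE pairingZl // mulf_eq0 (negbTE l0).
  by rewrite rmorph0 addr0.
have [/tLs|notLs] := boolP (affine_line iota u 0 \in Ls).
  by rewrite fiberE; right.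
left; apply/eqP; rewrite cards_eq0 fiberE -subset0; apply/subsetP => x.
rewrite inE => /andP[Hx ux].
have x0 : x != 0 by apply: contraNneq star_set_not0 => <-.
have /bigcupP[L LsL Lx] := subsetP HLs x Hx.
have /imset2P[v mu vS _ LE] := Ls_affine L LsL.
have mu0 : mu = 0.
  have := Ls0 L LsL; rewrite LE inE pairing0r add0r.
  by rewrite fmorph_eq0 => /eqP.
case/negP: notLs; suff -> : u = v by rewrite -mu0 -LE.
apply: (unit_circle_orthogonal_inj (x := x)) => //; apply/eqP.
  by move: ux; rewrite inE rmorph0 addr0.
by move: Lx; rewrite LE mu0 inE rmorph0 addr0.
Qed.

(** The lines through y that miss 0 have normal vectors a + c y, up to scaling,
    with c in F; there are q of them, one with each slope c.  A point x of H off
    the line 0y determines the line xy, whose slope is <a, x + y> / <y, x>.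
    Evenness puts such an x on every one of these lines, so the slopes of the q
    points of H off the line 0y cover F, hence are distinct.  The line of slope
    0, with normal vector a, therefore contains just one point besides y. *)
Lemma star_set_noncentral_secant a y :
    (forall b c, b != 0 -> ~~ odd #|fiber (pairing b) H (pairing b c)|) ->
    y \in H -> pairing a y != 0 ->
  #|fiber (pairing a) H (pairing a y)| = 2%N.
Proof.
move=> even_secants Hy ay.
have y0 : y != 0 by apply: contraNneq star_set_not0 => <-.
pose D := H :\: fiber (pairing y) H 0.
pose slope x := pairing a (x + y) / pairing y x.
have cardD : #|D| = #|F|.
  have [] := star_set_central_line y0.
    move/eqP; rewrite cards_eq0 => /eqP E0.
    by have := in_set0 y; rewrite -E0 inE Hy pairing_self eqxx.
  move=> cardy; apply: (@addIn t); case: H_star => <- _ _.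
  rewrite -[in RHS](cardsID (fiber (pairing y) H 0)) addnC -{1}cardy.
  congr (_ + _)%N; apply: eq_card => x.
  by rewrite !inE; case: (x \in H).
have D_slope x d : x \in H -> x != y ->
    pairing a (x + y) = d * pairing y x -> x \in D /\ slope x = d.
  move=> Hx xy xyd.
  have yx : pairing y x != 0.
    apply: contraNneq xy => yx; rewrite -addr_eq0_char2; apply/eqP.
    apply: (pairing_nondegenerate ay); first by rewrite xyd yx mulr0.
    by rewrite pairingDr yx pairing_self addr0.
  by rewrite !inE Hx yx; split; rewrite // /slope xyd mulfK.
have slope_onto : [set iota c | c in F] \subset [set slope x | x in D].
  apply/subsetP => _ /imsetP[c _ ->].
  pose b := a + iota c * y.
  have bE z : pairing b z = pairing a z + iota c * pairing y z.
    by rewrite pairingDl pairingZl ?bar_iota.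
  have b_y : pairing b y = pairing a y by rewrite bE pairing_self mulr0 addr0.
  have b0 : b != 0.
    by apply: contraNneq ay => b0; rewrite -b_y b0 pairing0l.
  have := even_secants b y b0.
  rewrite (cardsD1 y) inE Hy eqxx /= negbK => odd_b.
  have /card_gt0P[x] := odd_gt0 odd_b; rewrite !inE => /and3P[xy Hx /eqP bxy].
  have axy : pairing a (x + y) = iota c * pairing y x.
    apply/eqP; rewrite -addr_eq0_char2.
    have -> : pairing y x = pairing y (x + y).
      by rewrite pairingDr pairing_self addr0.
    by rewrite -bE pairingDr bxy addxx.
  by have [xD <-] := D_slope x (iota c) Hx xy axy; apply/imsetP; exists x.
have slope_inj : {in D &, injective slope}.
  apply/imset_injP; rewrite eqn_leq leq_imset_card cardD.
  by rewrite -(card_imset predT (fmorph_inj iota)) subset_leq_card.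
have a0 : a != 0 by apply: contraNneq ay => ->; rewrite pairing0l.
have := even_secants a y a0; rewrite (cardsD1 y) inE Hy eqxx /= negbK.
suff: (#|fiber (pairing a) H (pairing a y) :\ y| <= 1)%N by case: #|_| => [|[]].
apply/card_le1_eqP => x1 x2.
have in_D x : x \in fiber (pairing a) H (pairing a y) :\ y ->
    x \in D /\ slope x = 0.
  case/setD1P=> xy /setIdP[Hx /eqP axy]; apply: D_slope => //.
  by rewrite pairingDr axy addxx mul0r.
by move=> /in_D[D1 s1] /in_D[D2 s2]; apply: slope_inj; rewrite ?s1 ?s2.
Qed.

End StarSet.

(** * Points and lines of the projective plane *)

Lemma affine_in_line y a b :
  (affine iota y \in line iota a b) = (pairing a y == iota b).
Proof.
rewrite inE /= -addr_eq0_char2; apply/forall_inP/idP => [/(_ (y, 1))|yab].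
  rewrite mulr1; apply; apply/imsetP; exists 1; rewrite ?inE ?oner_eq0 //=.
  by rewrite rmorph1 !mul1r.
move=> _ /imsetP[c _ ->] /=; rewrite pairingZr ?bar_iota // mulr1 [b * c]mulrC.
by rewrite rmorphM -mulrDr mulf_eq0 yab orbT.
Qed.

Lemma affine_inj : injective (affine iota).
Proof.
move=> x y /(congr1 val) /= xy.
have : (x, 1) \in proj_class iota (x, 1).
  by apply/imsetP; exists 1; rewrite ?inE ?oner_eq0 //= rmorph1 !mul1r.
rewrite xy => /imsetP[c _ [->]] /=; rewrite mulr1 => <-.
by rewrite rmorph1 mul1r.
Qed.

Lemma card_affine_line (H : {set K}) a b :
  #|[set affine iota y | y in H] :&: line iota a b|
    = #|fiber (pairing a) H (iota b)|.
Proof.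
rewrite -(card_imset _ affine_inj); apply: eq_card => P.
apply/idP/imsetP => [|[y]]; rewrite inE.
  case/andP=> /imsetP[y Hy ->]; rewrite affine_in_line => yab.
  by exists y; rewrite ?inE ?Hy.
by case/andP=> Hy yab ->; rewrite inE affine_in_line imset_f.
Qed.

End HermitianPlane.

(** * The power-sum characterization *)

Theorem theorem1 (m : nat) (F K : finFieldType) (iota : {rmorphism F -> K})
    (hm : (1 <= m)%N) (hF : #|F| = (2 ^ m)%N) (hK : #|K| = (#|F| ^ 2)%N)
    (t : nat) (ht : (2 <= t)%N) (H : {set K}) (hH : star_set iota t H) :
  (KM_arc t [set affine iota y | y in H] /\
   t_nucleus t [set affine iota y | y in H] (affine iota 0))
  <->
  (forall v : K, v \in unit_circle F K ->
   forall k : nat, (1 <= k)%N -> (k <= #|F| - 2)%N ->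
     \sum_(y in H) pairing F v y ^+ k = 0).
Proof.
have char2 := pcharK2 iota hF.
have pairing_iota (a y : K) : exists c, pairing F a y = iota c.
  exact: bar_fixed (pairing_fixed iota hF hK a y).
have t_even := star_set_parameter_even hF ht hH.
split=> [[[cardA arcA] _] v vS k _ _|sums0].
  apply: power_sum0_of_even_fibers => // c.
  have v0 : v != 0.
    apply: contraTneq vS => ->; rewrite inE mul0r eq_sym; exact: oner_neq0.
  have [E0|[y]] := set_0Vmem (fiber (pairing F v) H c).
    by rewrite E0 cards0.
  rewrite inE => /andP[_ /eqP]; have [b ->] := pairing_iota v y => <-.
  rewrite -(card_affine_line iota hF).
  have /arcA : line iota v b \in lines iota.
    by apply/imsetP; exists (v, b); rewrite // inE xpair_eqE negb_and v0.
  by rewrite !inE => /or3P[]/eqP->.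
have even_secants (a c : K) : a != 0 ->
    ~~ odd #|fiber (pairing F a) H (pairing F a c)|.
  move=> a0; apply: (even_fibers_of_power_sum0 char2 (finNzRing_gt1 F)
    (pchar_nat_card iota hF)).
  - by move=> y _; apply: (pairing_fixed iota hF hK).
  - have [l [u [lq l0 uS ->]]] := polar_decomposition hF hK a0.
    move=> k k1 k2; under eq_bigr => y _ do rewrite pairingZl // exprMn.
    by rewrite -mulr_sumr sums0 ?mulr0.
  - exact: (star_set_card_even hF ht hH).
  - by case: (star_set_central_line hF hK ht hH a0) => ->.
  - exact: (pairing_fixed iota hF hK).
have noncentral (a : K) (b : F) : b != 0 ->
    #|fiber (pairing F a) H (iota b)| \in [:: 0; 2]%N.
  move=> b0; have [->|[y]] := set_0Vmem (fiber (pairing F a) H (iota b)).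
    by rewrite cards0.
  rewrite inE => /andP[Hy /eqP ab].
  by rewrite -ab (star_set_noncentral_secant hF hK ht hH) // ab fmorph_eq0.
have H0 := star_set_not0 ht hH.
split; first split.
- by rewrite card_imset; [case: hH | exact: affine_inj].
- move=> _ /imsetP[[a b] ab0 ->] /=; rewrite (card_affine_line iota hF).
  have [b0|/(noncentral a)] := eqVneq b 0; last first.
    by rewrite !inE orbA => ->.
  have a0 : a != 0 by move: ab0; rewrite inE b0 xpair_eqE eqxx andbT.
  rewrite b0 rmorph0 !inE.
  by case: (star_set_central_line hF hK ht hH a0) => ->; rewrite eqxx ?orbT.
rewrite /t_nucleus; case: eqP => [_|/eqP t2].
  by apply: contra H0 => /imsetP[y Hy /affine_inj->].
move=> _ [/imsetP[[a b] ab0 ->]] /=; rewrite (card_affine_line iota hF) => abt.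
rewrite (affine_in_line iota hF) (pairing0r iota hF) eq_sym fmorph_eq0.
apply: contraLR ht => /(noncentral a); rewrite abt !inE (negbTE t2) orbF.
by move/eqP->.
Qed.
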